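(* Let $\mathcal{G}$ be a strict 2-group presented by a crossed module $(G,H,\rhd,\partial)$ acting strictly on a small category $\mathbf{C}$ by $\Phi$. The horizontal 2-category $H(\mathbf{C}/\!\!/\mathcal{G})$ of the transformation double category $\mathbf{C}/\!\!/\mathcal{G}$ has the same objects and 1-morphisms as $\mathbf{C}$. Given objects $x,y$ of $\mathbf{C}$ and a pair of morphisms $f,f':x\to y$ in $\mathbf{C}$, the 2-morphisms in $\mathrm{Hom}(f,f')$ are labeled by the 2-morphisms $(1_G,\chi):1_G\Rightarrow 1_G$ of $\mathcal{G}$ such that $$f'=f\circ\Phi_{(1_G,\chi)}(x).$$ These 2-morphisms compose horizontally and vertically just as the endomorphisms of $1_G$ in $\mathcal{G}$.
   Context: A crossed module $(G,H,\rhd,\partial)$ consists of groups $G,H$, an action $\rhd$ of $G$ on $H$ by automorphisms, and a homomorphism $\partial:H\to G$ with $\partial(g\rhd\eta)=g\,\partial(\eta)g^{-1}$ and $\partial(\eta)\rhd\zeta=\eta\zeta\eta^{-1}$. The 2-group $\mathcal{G}$ presented by it is the strict 2-category with one object, 1-morphisms the elements of $G$ (composition = multiplication), and 2-morphisms $(\gamma,\chi)\in G\times H$, $(\gamma,\chi):\gamma\Rightarrow\partial(\chi)\gamma$, with vertical composition $(\partial(\chi)\gamma,\chi')\cdot(\gamma,\chi)=(\gamma,\chi'\chi)$, identities $(\gamma,1_H)$, and horizontal composition $(\gamma_1,\chi_1)\circ(\gamma_3,\chi_2)=(\gamma_1\gamma_3,\chi_1(\gamma_1\rhd\chi_2))$.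 Thus endomorphisms $(1_G,\chi)$ of $1_G$ are those with $\chi\in\ker\partial$. A strict action of $\mathcal{G}$ on $\mathbf{C}$ is a strict 2-functor $\Phi:\mathcal{G}\to\mathbf{Cat}$ sending the unique object to $\mathbf{C}$: endofunctors $\Phi_\gamma:\mathbf{C}\to\mathbf{C}$ and natural transformations $\Phi_{(\gamma,\chi)}:\Phi_\gamma\Rightarrow\Phi_{\partial(\chi)\gamma}$, strictly preserving all compositions and identities. Notation: $\gamma\blacktriangleright x=\Phi_\gamma(x)$ and $(\gamma,\chi)\blacktriangleright f=\Phi_{(\gamma,\chi)}(y)\circ\Phi_\gamma(f)$ for $f:x\to y$ in $\mathbf{C}$. The transformation double category $\mathbf{C}/\!\!/\mathcal{G}$ has: objects those of $\mathbf{C}$; horizontal category $\mathbf{C}$; vertical morphisms $(\gamma,x):x\to\gamma\blacktriangleright x$ for $\gamma\in G$, $x$ an object of $\mathbf{C}$, with $(\gamma',\gamma\blacktriangleright x)\circ(\gamma,x)=(\gamma'\gamma,x)$ (so $(1_G,x)$ is the identity of $x$); squares $((\gamma,\chi),f)$, $(\gamma,\chi)\in G\times H$, $f:x\to y$ in $\mathbf{C}$, with left edge $(\gamma,x)$, right edge $(\partial(\chi)\gamma,y)$, top edge (vertical source) $f$, bottom edge (vertical target) $(\gamma,\chi)\blacktriangleright f$; horizontal composition $((\partial(\chi_1)\gamma_1,\chi_2),g)\circ_h((\gamma_1,\chi_1),f)=((\gamma_1,\chi_2\chi_1),g\circ f)$; vertical composition $((\gamma_1,\chi_1),(\gamma_3,\chi_2)\blacktriangleright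 f)\circ_v((\gamma_3,\chi_2),f)=((\gamma_1\gamma_3,\chi_1(\gamma_1\rhd\chi_2)),f)$. The horizontal 2-category $H(\mathcal{D})$ of a double category $\mathcal{D}$ has the same objects and 1-morphisms as the horizontal category of $\mathcal{D}$; its 2-morphisms are the squares of $\mathcal{D}$ whose two vertical boundary morphisms are identities, regarded as 2-morphisms from the vertical source to the vertical target, with the compositions of squares in $\mathcal{D}$. *)

(* Defs.v *)
From mathcomp Require Import all_boot.
From mathcomp Require Import boolp classical_sets functions.

Set Implicit Arguments.
Unset Strict Implicit.
Unset Printing Implicit Defensive.

Local Open Scope group_scope.

(* The structure of a small category with set of objects O and set of
   morphisms M. Morphisms are single-sorted, so that the strict equalities
   between objects occurring in 2-functors and double categories need no
   transport; [ccomp g f e] is "g after f" and only exists for composable pairs.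
   The laws quantify over all the composability proofs involved (those not
   assumed to hold in a law are consequences of the other laws). *)
Record cat_on (O M : Type) := CatOn {
  src : M -> O;
  tgt : M -> O;
  idm : O -> M;
  ccomp : forall g f : M, tgt f = src g -> M;
  src_id : forall x, src (idm x) = x;
  tgt_id : forall x, tgt (idm x) = x;
  src_comp : forall g f e, src (@ccomp g f e) = src f;
  tgt_comp : forall g f e, tgt (@ccomp g f e) = tgt g;
  comp_idl : forall f e, @ccomp (idm (tgt f)) f e = f;
  comp_idr : forall f e, @ccomp f (idm (src f)) e = f;
  compA : forall h g f e1 e2 e3 e4,
    @ccomp h (@ccomp g f e1) e2 = @ccomp (@ccomp h g e3) f e4 }.

Arguments ccomp {O M} c g f e.
Arguments compA {O M c h g f} e1 e2 e3 e4.

Record category := Category {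
  ob : Type;
  mor : Type;
  cat_str :> cat_on ob mor }.

Arguments Category {ob mor} cat_str.

Record is_functor (O M O' M' : Type) (C : cat_on O M) (D : cat_on O' M')
    (F0 : O -> O') (F1 : M -> M') : Prop := IsFunctor {
  fun_src : forall f, src D (F1 f) = F0 (src C f);
  fun_tgt : forall f, tgt D (F1 f) = F0 (tgt C f);
  fun_id : forall x, F1 (idm C x) = idm D (F0 x);
  fun_comp : forall g f e e', F1 (ccomp C g f e) = ccomp D (F1 g) (F1 f) e' }.

Lemma comp_congr (O M : Type) (C : cat_on O M) g f g' f' e e' :
  g = g' -> f = f' -> ccomp C g f e = ccomp C g' f' e'.
Proof. by move=> eg ef; subst; congr ccomp; exact: Prop_irrelevance. Qed.

Lemma comp_id_l (O M : Type) (C : cat_on O M) x f e : ccomp C (idm C x) f e = f.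
Proof.
have ex : tgt C f = x by rewrite e src_id.
by subst x; rewrite comp_idl.
Qed.

Lemma comp_id_r (O M : Type) (C : cat_on O M) x f e : ccomp C f (idm C x) e = f.
Proof.
have ex : src C f = x by rewrite -e tgt_id.
by subst x; rewrite comp_idr.
Qed.

Lemma comp_exchange (O M : Type) (C : cat_on O M) p q r s r' q'
    e1 e2 e3 e4 e5 e6 e7 e8 :
  ccomp C q r e1 = ccomp C r' q' e2 ->
  ccomp C (ccomp C p q e3) (ccomp C r s e4) e5 =
  ccomp C (ccomp C p r' e6) (ccomp C q' s e7) e8.
Proof.
move=> eqr.
have f1 : tgt C (ccomp C r s e4) = src C q by rewrite tgt_comp.
have f2 : tgt C (ccomp C q (ccomp C r s e4) f1) = src C p by rewrite tgt_comp.
have f3 : tgt C s = src C (ccomp C q r e1) by rewrite src_comp.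
have f4 : tgt C (ccomp C q' s e7) = src C r' by rewrite tgt_comp.
have f5 : tgt C (ccomp C r' (ccomp C q' s e7) f4) = src C p by rewrite tgt_comp.
have f6 : tgt C s = src C (ccomp C r' q' e2) by rewrite src_comp.
rewrite -(compA f1 f2 e3 e5) -(compA f4 f5 e6 e8); apply: comp_congr => //.
by rewrite (compA e4 f1 e1 f3) (compA e7 f4 e2 f6); exact: comp_congr.
Qed.

(* [vert] and [horz] are the vertical and horizontal compositions of 2-cells. *)
Record strict_2cat := Strict2Cat {
  cell0 : Type;
  cell1 : Type;
  cell2 : Type;
  cells1 : cat_on cell0 cell1;
  vert : cat_on cell1 cell2;
  horz : cat_on cell0 cell2;
  src_src : forall a, src cells1 (src vert a) = src horz a;
  src_tgt : forall a, src cells1 (tgt vert a) = src horz a;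
  tgt_src : forall a, tgt cells1 (src vert a) = tgt horz a;
  tgt_tgt : forall a, tgt cells1 (tgt vert a) = tgt horz a;
  src_horz : forall b a e e',
    src vert (ccomp horz b a e) = ccomp cells1 (src vert b) (src vert a) e';
  tgt_horz : forall b a e e',
    tgt vert (ccomp horz b a e) = ccomp cells1 (tgt vert b) (tgt vert a) e';
  id_id : forall x, idm horz x = idm vert (idm cells1 x);
  id_horz : forall g f e e',
    idm vert (ccomp cells1 g f e) = ccomp horz (idm vert g) (idm vert f) e';
  interchange : forall b' b a' a e1 e2 e3 e4 e5 e6,
    ccomp vert (ccomp horz b' a' e1) (ccomp horz b a e2) e3 =
    ccomp horz (ccomp vert b' b e4) (ccomp vert a' a e5) e6 }.

Record strict_2functor (S T : strict_2cat) := Strict2Functor {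
  map0 : cell0 S -> cell0 T;
  map1 : cell1 S -> cell1 T;
  map2 : cell2 S -> cell2 T;
  map_cells1 : is_functor (cells1 S) (cells1 T) map0 map1;
  map_vert : is_functor (vert S) (vert T) map1 map2;
  map_horz : is_functor (horz S) (horz T) map0 map2 }.

(* A square has [sqv] (vertical source = top edge, vertical target = bottom
   edge, vertical composition) and [sqh] (horizontal source = left edge,
   horizontal target = right edge, horizontal composition). *)
Record double_category := DoubleCategory {
  dobj : Type;
  dhmor : Type;
  dvmor : Type;
  square : Type;
  hor : cat_on dobj dhmor;
  ver : cat_on dobj dvmor;
  sqh : cat_on dvmor square;
  sqv : cat_on dhmor square;
  corner_tl : forall s, src hor (src sqv s) = src ver (src sqh s);
  corner_tr : forall s, tgt hor (src sqv s) = src ver (tgt sqh s);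
  corner_bl : forall s, src hor (tgt sqv s) = tgt ver (src sqh s);
  corner_br : forall s, tgt hor (tgt sqv s) = tgt ver (tgt sqh s);
  top_sqh : forall t s e e',
    src sqv (ccomp sqh t s e) = ccomp hor (src sqv t) (src sqv s) e';
  bot_sqh : forall t s e e',
    tgt sqv (ccomp sqh t s e) = ccomp hor (tgt sqv t) (tgt sqv s) e';
  left_sqv : forall t s e e',
    src sqh (ccomp sqv t s e) = ccomp ver (src sqh t) (src sqh s) e';
  right_sqv : forall t s e e',
    tgt sqh (ccomp sqv t s e) = ccomp ver (tgt sqh t) (tgt sqh s) e';
  top_idh : forall u, src sqv (idm sqh u) = idm hor (src ver u);
  bot_idh : forall u, tgt sqv (idm sqh u) = idm hor (tgt ver u);
  left_idv : forall f, src sqh (idm sqv f) = idm ver (src hor f);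
  right_idv : forall f, tgt sqh (idm sqv f) = idm ver (tgt hor f);
  idh_ver : forall v u e e',
    idm sqh (ccomp ver v u e) = ccomp sqv (idm sqh v) (idm sqh u) e';
  idv_hor : forall g f e e',
    idm sqv (ccomp hor g f e) = ccomp sqh (idm sqv g) (idm sqv f) e';
  idh_idv : forall x, idm sqh (idm ver x) = idm sqv (idm hor x);
  sq_interchange : forall t' t s' s e1 e2 e3 e4 e5 e6,
    ccomp sqv (ccomp sqh t' s' e1) (ccomp sqh t s e2) e3 =
    ccomp sqh (ccomp sqv t' t e4) (ccomp sqv s' s e5) e6 }.

Section Horizontal2Category.

Variable D : double_category.

Definition is_identity (u : dvmor D) : Prop := exists x, u = idm (ver D) x.

Definition hsquare : Type :=
  {s : square D | is_identity (src (sqh D) s) /\ is_identity (tgt (sqh D) s)}.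

Lemma hsquare_eq (s t : hsquare) : sval s = sval t -> s = t.
Proof.
case: s t => [s p] [t q] /= e; subst t; congr exist; exact: Prop_irrelevance.
Qed.

Definition hs_src (s : hsquare) : dobj D := src (ver D) (src (sqh D) (sval s)).
Definition hs_tgt (s : hsquare) : dobj D := src (ver D) (tgt (sqh D) (sval s)).

Lemma hs_left (s : hsquare) : src (sqh D) (sval s) = idm (ver D) (hs_src s).
Proof. by rewrite /hs_src; have [[x ->] _] := svalP s; rewrite src_id. Qed.

Lemma hs_right (s : hsquare) : tgt (sqh D) (sval s) = idm (ver D) (hs_tgt s).
Proof. by rewrite /hs_tgt; have [_ [x ->]] := svalP s; rewrite src_id. Qed.

Lemma hs_srcE (s : hsquare) : src (hor D) (src (sqv D) (sval s)) = hs_src s.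
Proof. exact: corner_tl. Qed.

Lemma hs_tgtE (s : hsquare) : tgt (hor D) (src (sqv D) (sval s)) = hs_tgt s.
Proof. exact: corner_tr. Qed.

Lemma hs_srcE' (s : hsquare) : src (hor D) (tgt (sqv D) (sval s)) = hs_src s.
Proof. by rewrite corner_bl hs_left tgt_id. Qed.

Lemma hs_tgtE' (s : hsquare) : tgt (hor D) (tgt (sqv D) (sval s)) = hs_tgt s.
Proof. by rewrite corner_br hs_right tgt_id. Qed.

Lemma hs_idP (f : dhmor D) :
  is_identity (src (sqh D) (idm (sqv D) f)) /\
  is_identity (tgt (sqh D) (idm (sqv D) f)).
Proof.
split; first by exists (src (hor D) f); rewrite left_idv.
by exists (tgt (hor D) f); rewrite right_idv.
Qed.

Lemma hs_vcompP (t s : hsquare)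
    (e : tgt (sqv D) (sval s) = src (sqv D) (sval t)) :
  is_identity (src (sqh D) (ccomp (sqv D) (sval t) (sval s) e)) /\
  is_identity (tgt (sqh D) (ccomp (sqv D) (sval t) (sval s) e)).
Proof.
have es : hs_src t = hs_src s by rewrite -hs_srcE -e hs_srcE'.
have et : hs_tgt t = hs_tgt s by rewrite -hs_tgtE -e hs_tgtE'.
split.
  exists (hs_src s).
  have e' : tgt (ver D) (src (sqh D) (sval s)) =
            src (ver D) (src (sqh D) (sval t)).
    by rewrite !hs_left es src_id tgt_id.
  rewrite (left_sqv e e').
  move: e'; rewrite !hs_left es => e'; exact: comp_id_l.
exists (hs_tgt s).
have e' : tgt (ver D) (tgt (sqh D) (sval s)) =
          src (ver D) (tgt (sqh D) (sval t)).
  by rewrite !hs_right et src_id tgt_id.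
rewrite (right_sqv e e').
move: e'; rewrite !hs_right et => e'; exact: comp_id_l.
Qed.

Lemma hs_hcomp_proof (t s : hsquare) :
  hs_tgt s = hs_src t -> tgt (sqh D) (sval s) = src (sqh D) (sval t).
Proof. by move=> e; rewrite hs_left hs_right e. Qed.

Lemma hs_hcompP (t s : hsquare)
    (e : tgt (sqh D) (sval s) = src (sqh D) (sval t)) :
  is_identity (src (sqh D) (ccomp (sqh D) (sval t) (sval s) e)) /\
  is_identity (tgt (sqh D) (ccomp (sqh D) (sval t) (sval s) e)).
Proof.
split; first by exists (hs_src s); rewrite src_comp hs_left.
by exists (hs_tgt t); rewrite tgt_comp hs_right.
Qed.

Definition hs_id (f : dhmor D) : hsquare := exist _ _ (hs_idP f).

Definition hs_vcomp (t s : hsquare)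
    (e : tgt (sqv D) (sval s) = src (sqv D) (sval t)) : hsquare :=
  exist _ _ (hs_vcompP e).

Definition hs_hcomp (t s : hsquare) (e : hs_tgt s = hs_src t) : hsquare :=
  exist _ _ (hs_hcompP (hs_hcomp_proof e)).

Definition hs_vert : cat_on (dhmor D) hsquare.
Proof.
refine (@CatOn _ _ (fun s => src (sqv D) (sval s))
                   (fun s => tgt (sqv D) (sval s)) hs_id hs_vcomp
                   _ _ _ _ _ _ _).
- by move=> f; rewrite /= src_id.
- by move=> f; rewrite /= tgt_id.
- by move=> t s e; rewrite /= src_comp.
- by move=> t s e; rewrite /= tgt_comp.
- by move=> s e; apply: hsquare_eq; exact: comp_idl.
- by move=> s e; apply: hsquare_eq; exact: comp_idr.
- by move=> u t s e1 e2 e3 e4; apply: hsquare_eq; exact: compA.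
Defined.

Definition hs_horz : cat_on (dobj D) hsquare.
Proof.
refine (@CatOn _ _ hs_src hs_tgt (fun x => hs_id (idm (hor D) x)) hs_hcomp
                   _ _ _ _ _ _ _).
- by move=> x; rewrite -hs_srcE /= !src_id.
- by move=> x; rewrite -hs_tgtE /= src_id tgt_id.
- by move=> t s e; rewrite /hs_src /= src_comp.
- by move=> t s e; rewrite /hs_tgt /= tgt_comp.
- move=> s e; apply: hsquare_eq => /=.
  move: (hs_hcomp_proof _); rewrite /= -idh_idv => e'; exact: comp_id_l.
- move=> s e; apply: hsquare_eq => /=.
  move: (hs_hcomp_proof _); rewrite /= -idh_idv => e'; exact: comp_id_r.
- by move=> u t s e1 e2 e3 e4; apply: hsquare_eq; exact: compA.
Defined.

Definition horizontal_2cat : strict_2cat.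
Proof.
refine (@Strict2Cat (dobj D) (dhmor D) hsquare (hor D) hs_vert hs_horz
                    _ _ _ _ _ _ _ _ _).
- exact: hs_srcE.
- exact: hs_srcE'.
- exact: hs_tgtE.
- exact: hs_tgtE'.
- by move=> t s e e'; exact: top_sqh.
- by move=> t s e e'; exact: bot_sqh.
- by [].
- by move=> g f e e'; apply: hsquare_eq; exact: idv_hor.
- by move=> t' t s' s *; apply: hsquare_eq; exact: sq_interchange.
Defined.

End Horizontal2Category.

Record crossed_module := CrossedModule {
  xG : groupType;
  xH : groupType;
  xact : xG -> xH -> xH;
  bd : xH -> xG;
  xact1 : forall h, xact 1 h = h;
  xactM : forall g g' h, xact (g * g') h = xact g (xact g' h);
  xact_mul : forall g h h', xact g (h * h') = xact g h * xact g h';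
  bdM : forall h h', bd (h * h') = bd h * bd h';
  bd_act : forall g h, bd (xact g h) = g * bd h * g^-1;
  peiffer : forall h h', xact (bd h) h' = h * h' * h^-1 }.

Section TwoGroup.

Variable X : crossed_module.

Local Notation G := (xG X).
Local Notation H := (xH X).

Lemma bd1 : bd (1 : H) = 1 :> G.
Proof. by apply: (mulgI (bd (1 : H))); rewrite -bdM !mulg1. Qed.

Lemma xact_1 (g : G) : xact g 1 = 1 :> H.
Proof. by apply: (mulgI (xact g 1)); rewrite -xact_mul !mulg1. Qed.

Definition tg_src (a : G * H) : G := a.1.
Definition tg_tgt (a : G * H) : G := bd a.2 * a.1.
Definition tg_vcomp (b a : G * H) : G * H := (a.1, b.2 * a.2).
Definition tg_hcomp (b a : G * H) : G * H := (b.1 * a.1, b.2 * xact b.1 a.2).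

Lemma tg_tgt_hcomp (b a : G * H) :
  tg_tgt (tg_hcomp b a) = tg_tgt b * tg_tgt a.
Proof. by rewrite /tg_tgt /= bdM bd_act !mulgA mulgVK. Qed.

Definition tg_cells1 : cat_on unit G.
Proof.
refine (@CatOn _ _ (fun=> tt) (fun=> tt) (fun=> 1) (fun g f _ => g * f)
               _ _ _ _ _ _ _) => //.
- by case.
- by case.
- by move=> f _; exact: mul1g.
- by move=> f _; exact: mulg1.
- by move=> h g f *; exact: mulgA.
Defined.

Definition tg_vert : cat_on G (G * H)%type.
Proof.
refine (@CatOn _ _ tg_src tg_tgt (fun g => (g, 1)) (fun b a _ => tg_vcomp b a)
               _ _ _ _ _ _ _) => //.
- by move=> g; rewrite /tg_tgt /= bd1 mul1g.
- by move=> b a e; rewrite /tg_tgt /= bdM -mulgA -/(tg_tgt a) e.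
- by move=> [g h] _; rewrite /tg_vcomp /= mul1g.
- by move=> [g h] _; rewrite /tg_vcomp /= mulg1.
- by move=> c b a *; rewrite /tg_vcomp /= mulgA.
Defined.

Definition tg_horz : cat_on unit (G * H)%type.
Proof.
refine (@CatOn _ _ (fun=> tt) (fun=> tt) (fun=> (1, 1))
               (fun b a _ => tg_hcomp b a)
               _ _ _ _ _ _ _) => //.
- by case.
- by case.
- by move=> [g h] _; rewrite /tg_hcomp /= !mul1g xact1.
- by move=> [g h] _; rewrite /tg_hcomp /= xact_1 !mulg1.
- by move=> c b a *; rewrite /tg_hcomp /= xact_mul xactM !mulgA.
Defined.

Definition two_group : strict_2cat.
Proof.
refine (@Strict2Cat unit G (G * H)%type tg_cells1 tg_vert tg_horz
                    _ _ _ _ _ _ _ _ _) => //.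
- by move=> b a *; exact: tg_tgt_hcomp.
- by move=> g f *; rewrite /= /tg_hcomp /= xact_1 mul1g.
- move=> [g' h'] [g h] [k' i'] [k i] e1 e2 e3.
  rewrite /= /tg_src /tg_tgt /= => e4 e5 e6.
  rewrite /tg_vcomp /tg_hcomp /=; congr pair.
  by rewrite -e4 xactM peiffer xact_mul !mulgA mulgVK.
Defined.

End TwoGroup.

Record endofunctor (C : category) := Endofunctor {
  on_ob : ob C -> ob C;
  on_mor : mor C -> mor C;
  endoP : is_functor C C on_ob on_mor }.

Record nat_trans (C : category) := NatTrans {
  nt_dom : endofunctor C;
  nt_cod : endofunctor C;
  nt_at : ob C -> mor C;
  nt_at_src : forall x, src C (nt_at x) = on_ob nt_dom x;
  nt_at_tgt : forall x, tgt C (nt_at x) = on_ob nt_cod x;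
  nt_natural : forall f e e',
    ccomp C (nt_at (tgt C f)) (on_mor nt_dom f) e =
    ccomp C (on_mor nt_cod f) (nt_at (src C f)) e' }.

Section End2Category.

Variable C : category.

Implicit Types (F G : endofunctor C) (a b : nat_trans C).

Lemma endofunctor_eq F G :
  on_ob F =1 on_ob G -> on_mor F =1 on_mor G -> F = G.
Proof.
case: F G => [F0 F1 FP] [G0 G1 GP] /= /funext e0 /funext e1; subst G0 G1.
by congr Endofunctor; exact: Prop_irrelevance.
Qed.

Lemma nat_trans_eq a b :
  nt_dom a = nt_dom b -> nt_cod a = nt_cod b -> nt_at a =1 nt_at b -> a = b.
Proof.
case: a b => [F G a p q r] [F' G' a' p' q' r'] /= e1 e2 /funext e3.
by subst F' G' a'; congr NatTrans; exact: Prop_irrelevance.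
Qed.

Lemma endo_idP : is_functor C C id id.
Proof. by split=> // g f e e'; exact: comp_congr. Qed.

Definition endo_id := Endofunctor endo_idP.

Lemma endo_compP G F :
  is_functor C C (on_ob G \o on_ob F) (on_mor G \o on_mor F).
Proof.
split=> [f|f|x|g f e e'] /=.
- by rewrite !(fun_src (endoP _)).
- by rewrite !(fun_tgt (endoP _)).
- by rewrite !(fun_id (endoP _)).
have e1 : tgt C (on_mor F f) = src C (on_mor F g).
  by rewrite (fun_tgt (endoP _)) (fun_src (endoP _)) e.
rewrite (fun_comp (endoP F) e e1); exact: (fun_comp (endoP G)).
Qed.

Definition endo_comp G F := Endofunctor (endo_compP G F).

Definition endo_cells1 : cat_on unit (endofunctor C).
Proof.
refine (@CatOn _ _ (fun=> tt) (fun=> tt) (fun=> endo_id)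
               (fun G F _ => endo_comp G F) _ _ _ _ _ _ _) => //.
- by case.
- by case.
- by move=> F e; apply: endofunctor_eq.
- by move=> F e; apply: endofunctor_eq.
- by move=> H G F *; apply: endofunctor_eq.
Defined.

Lemma nt_idP_nat F f e e' :
  ccomp C (idm C (on_ob F (tgt C f))) (on_mor F f) e =
  ccomp C (on_mor F f) (idm C (on_ob F (src C f))) e'.
Proof. by rewrite comp_id_l comp_id_r. Qed.

Definition nt_id F : nat_trans C :=
  @NatTrans C F F (fun x => idm C (on_ob F x))
    (fun x => src_id C (on_ob F x)) (fun x => tgt_id C (on_ob F x))
    (@nt_idP_nat F).

Section Vertical.

Variables (b a : nat_trans C) (e : nt_cod a = nt_dom b).

Lemma nt_vcomp_proof x : tgt C (nt_at a x) = src C (nt_at b x).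
Proof. by rewrite nt_at_tgt nt_at_src e. Qed.

Definition nt_vcomp_at x : mor C :=
  ccomp C (nt_at b x) (nt_at a x) (nt_vcomp_proof x).

Lemma nt_vcomp_src x : src C (nt_vcomp_at x) = on_ob (nt_dom a) x.
Proof. by rewrite src_comp nt_at_src. Qed.

Lemma nt_vcomp_tgt x : tgt C (nt_vcomp_at x) = on_ob (nt_cod b) x.
Proof. by rewrite tgt_comp nt_at_tgt. Qed.

Lemma nt_vcomp_nat f e1 e2 :
  ccomp C (nt_vcomp_at (tgt C f)) (on_mor (nt_dom a) f) e1 =
  ccomp C (on_mor (nt_cod b) f) (nt_vcomp_at (src C f)) e2.
Proof.
have p1 : tgt C (on_mor (nt_dom a) f) = src C (nt_at a (tgt C f)).
  by rewrite (fun_tgt (endoP _)) nt_at_src.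
have p2 : tgt C (ccomp C (nt_at a (tgt C f)) (on_mor (nt_dom a) f) p1)
          = src C (nt_at b (tgt C f)).
  by rewrite tgt_comp nt_vcomp_proof.
rewrite /nt_vcomp_at -(compA p1 p2 (nt_vcomp_proof _) e1).
have p3 : tgt C (nt_at a (src C f)) = src C (on_mor (nt_cod a) f).
  by rewrite (fun_src (endoP _)) nt_at_tgt.
have p4 : tgt C (on_mor (nt_cod a) f) = src C (nt_at b (tgt C f)).
  by rewrite (fun_tgt (endoP _)) nt_at_src e.
have p5 : tgt C (ccomp C (on_mor (nt_cod a) f) (nt_at a (src C f)) p3)
          = src C (nt_at b (tgt C f)).
  by rewrite tgt_comp.
have p6 : tgt C (nt_at a (src C f)) =
   src C (ccomp C (nt_at b (tgt C f)) (on_mor (nt_cod a) f) p4).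
  by rewrite src_comp.
transitivity (ccomp C _ _ p5).
  by apply: comp_congr => //; exact: nt_natural.
rewrite (compA p3 p5 p4 p6).
have p7 : tgt C (nt_at b (src C f)) = src C (on_mor (nt_cod b) f).
  by rewrite (fun_src (endoP _)) nt_at_tgt.
have p8 : tgt C (nt_at a (src C f)) =
   src C (ccomp C (on_mor (nt_cod b) f) (nt_at b (src C f)) p7).
  by rewrite src_comp nt_vcomp_proof.
rewrite (compA _ _ p7 p8); apply: comp_congr => //.
have p9 : tgt C (on_mor (nt_dom b) f) = src C (nt_at b (tgt C f)) by rewrite -e.
by rewrite -(nt_natural p9); apply: comp_congr => //; rewrite e.
Qed.

Definition nt_vcomp : nat_trans C :=
  NatTrans nt_vcomp_src nt_vcomp_tgt nt_vcomp_nat.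

End Vertical.

Section Horizontal.

Variables (b a : nat_trans C).

Lemma nt_hcomp_proof x :
  tgt C (on_mor (nt_dom b) (nt_at a x)) = src C (nt_at b (on_ob (nt_cod a) x)).
Proof. by rewrite (fun_tgt (endoP _)) nt_at_tgt nt_at_src. Qed.

Definition nt_hcomp_at x : mor C :=
  ccomp C (nt_at b (on_ob (nt_cod a) x)) (on_mor (nt_dom b) (nt_at a x))
       (nt_hcomp_proof x).

Lemma nt_hcomp_src x :
  src C (nt_hcomp_at x) = on_ob (endo_comp (nt_dom b) (nt_dom a)) x.
Proof. by rewrite src_comp (fun_src (endoP _)) nt_at_src. Qed.

Lemma nt_hcomp_tgt x :
  tgt C (nt_hcomp_at x) = on_ob (endo_comp (nt_cod b) (nt_cod a)) x.
Proof. by rewrite tgt_comp nt_at_tgt. Qed.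

Lemma nt_hcomp_nat f e1 e2 :
  ccomp C (nt_hcomp_at (tgt C f))
    (on_mor (endo_comp (nt_dom b) (nt_dom a)) f) e1
  = ccomp C (on_mor (endo_comp (nt_cod b) (nt_cod a)) f)
      (nt_hcomp_at (src C f)) e2.
Proof.
have Fs := fun_src (endoP _); have Ft := fun_tgt (endoP _).
rewrite /nt_hcomp_at.
set F := nt_dom b; set y := src C f; set z := tgt C f.
have q1 : tgt C (on_mor (nt_dom a) f) = src C (nt_at a z).
  by rewrite Ft nt_at_src.
have q2 : tgt C (nt_at a y) = src C (on_mor (nt_cod a) f).
  by rewrite Fs nt_at_tgt.
have nat_a : ccomp C _ _ q1 = ccomp C _ _ q2 := nt_natural q1 q2.
have p1 : tgt C (on_mor F (on_mor (nt_dom a) f)) = src C (on_mor F (nt_at a z)).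
  by rewrite Ft Fs q1.
have p2 : tgt C (on_mor F (nt_at a y)) = src C (on_mor F (on_mor (nt_cod a) f)).
  by rewrite Ft Fs q2.
have Fnat : ccomp C _ _ p1 = ccomp C _ _ p2.
  by rewrite -(fun_comp (endoP F) q1) -(fun_comp (endoP F) q2) nat_a.
have p3 : tgt C (ccomp C _ _ p1) = src C (nt_at b (on_ob (nt_cod a) z)).
  by rewrite tgt_comp Ft nt_at_tgt nt_at_src.
rewrite -(compA p1 p3 (nt_hcomp_proof _) e1).
have p4 : tgt C (ccomp C _ _ p2) = src C (nt_at b (on_ob (nt_cod a) z)).
  by rewrite -Fnat.
transitivity (ccomp C _ _ p4); first by apply: comp_congr.
have p5 : tgt C (on_mor F (on_mor (nt_cod a) f)) =
          src C (nt_at b (on_ob (nt_cod a) z)).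
  by rewrite -p4 tgt_comp.
have p6 : tgt C (on_mor F (nt_at a y)) = src C (ccomp C _ _ p5).
  by rewrite src_comp.
rewrite (compA p2 p4 p5 p6).
have p7 : tgt C (nt_at b (on_ob (nt_cod a) y)) =
          src C (on_mor (nt_cod b) (on_mor (nt_cod a) f)).
  by rewrite nt_at_tgt !Fs.
have p8 : tgt C (on_mor F (nt_at a y)) = src C (ccomp C _ _ p7).
  by rewrite src_comp nt_hcomp_proof.
rewrite (compA _ _ p7 p8); apply: comp_congr => //.
have g1 : src C (on_mor (nt_cod a) f) = on_ob (nt_cod a) y by rewrite Fs.
have g2 : tgt C (on_mor (nt_cod a) f) = on_ob (nt_cod a) z by rewrite Ft.
by clear p4 p6 p8; move: p5 p7; rewrite -g1 -g2 => p5 p7; exact: nt_natural.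
Qed.

Definition nt_hcomp : nat_trans C :=
  NatTrans nt_hcomp_src nt_hcomp_tgt nt_hcomp_nat.

End Horizontal.

Definition endo_vert : cat_on (endofunctor C) (nat_trans C).
Proof.
refine (@CatOn _ _ (@nt_dom C) (@nt_cod C) nt_id nt_vcomp _ _ _ _ _ _ _) => //.
- by move=> a e; apply: nat_trans_eq => // x; exact: comp_id_l.
- by move=> a e; apply: nat_trans_eq => // x; exact: comp_id_r.
- by move=> c b a *; apply: nat_trans_eq => // x; exact: compA.
Defined.

Definition endo_horz : cat_on unit (nat_trans C).
Proof.
refine (@CatOn _ _ (fun=> tt) (fun=> tt) (fun=> nt_id endo_id)
               (fun b a _ => nt_hcomp b a) _ _ _ _ _ _ _) => //.
- by case.
- by case.
- move=> a e; apply: nat_trans_eq => [||x]; try exact: endofunctor_eq.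
  exact: comp_id_l.
- move=> a e; apply: nat_trans_eq => [||x]; try exact: endofunctor_eq.
  have p : tgt C (idm C (on_ob (nt_dom a) x)) = src C (nt_at a x).
    by rewrite tgt_id nt_at_src.
  transitivity (ccomp C _ _ p); last exact: comp_id_r.
  by apply: comp_congr => //=; rewrite (fun_id (endoP _)).
- move=> c b a *; apply: nat_trans_eq => [||x]; try exact: endofunctor_eq.
  have p : tgt C (on_mor (nt_dom c) (on_mor (nt_dom b) (nt_at a x))) =
      src C (on_mor (nt_dom c) (nt_at b (on_ob (nt_cod a) x))).
    by rewrite (fun_tgt (endoP _)) (fun_src (endoP _)) nt_hcomp_proof.
  have q : tgt C (ccomp C _ _ p) =
           src C (nt_at c (on_ob (nt_cod (nt_hcomp b a)) x)).
    by rewrite tgt_comp nt_hcomp_proof.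
  transitivity (ccomp C _ _ q); last exact: compA.
  by apply: comp_congr; last exact: (fun_comp (endoP _)).
Defined.

(* The full sub-2-category of the strict 2-category of categories on the single
   object C. *)
Definition End2 : strict_2cat.
Proof.
refine (@Strict2Cat unit (endofunctor C) (nat_trans C)
   endo_cells1 endo_vert endo_horz _ _ _ _ _ _ _ _ _) => //.
- move=> G F e e'; apply: nat_trans_eq => // x.
  by rewrite /= /nt_hcomp_at comp_id_l /= (fun_id (endoP _)).
- move=> b' b a' a e1 e2 e3 e4 e5 e6; apply: nat_trans_eq => // x.
  have d4 : nt_cod b = nt_dom b' := e4; have d5 : nt_cod a = nt_dom a' := e5.
  pose f := nt_at a' x.
  have ex : src C f = on_ob (nt_cod a) x by rewrite nt_at_src d5.
  have ey : tgt C f = on_ob (nt_cod a') x by rewrite nt_at_tgt.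
  have m1 : tgt C (on_mor (nt_dom b) f) = src C (nt_at b (tgt C f)).
    by rewrite (fun_tgt (endoP _)) nt_at_src.
  have m2 : tgt C (nt_at b (src C f)) = src C (on_mor (nt_cod b) f).
    by rewrite (fun_src (endoP _)) nt_at_tgt.
  have n1 : tgt C (nt_at b (on_ob (nt_cod a) x)) = src C (on_mor (nt_dom b') f).
    by rewrite -ex -d4.
  have n2 : tgt C (on_mor (nt_dom b) f) = src C (nt_at b (on_ob (nt_cod a') x)).
    by rewrite -ey.
  have nat_b : ccomp C _ _ n1 = ccomp C _ _ n2.
    transitivity (ccomp C _ _ m2); first by apply: comp_congr; rewrite -?d4 ?ex.
    by rewrite -(nt_natural m1 m2); apply: comp_congr; rewrite ?ey.
  have p : tgt C (on_mor (nt_dom b) (nt_at a x)) = src C (on_mor (nt_dom b) f).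
    by rewrite (fun_tgt (endoP _)) (fun_src (endoP _)) nt_at_tgt nt_at_src d5.
  have q : tgt C (ccomp C _ _ p) = src C (nt_vcomp_at e4 (on_ob (nt_cod a') x)).
    by rewrite src_comp tgt_comp n2.
  transitivity (ccomp C _ _ q); first exact: (comp_exchange _ _ nat_b).
  by apply: comp_congr => //; apply: esym; exact: (fun_comp (endoP _)).
Defined.

End End2Category.

(* A strict 2-functor into the 2-category of categories which sends the only
   object of the 2-group to C is the same thing as a strict 2-functor into the
   full sub-2-category on C. *)
Definition strict_action (X : crossed_module) (C : category) : Type :=
  strict_2functor (two_group X) (End2 C).

Section TransformationDoubleCategory.

Variables (X : crossed_module) (C : category) (Phi : strict_action X C).

Local Notation G := (xG X).
Local Notation H := (xH X).

Definition act1 (g : G) : endofunctor C := map1 Phi g.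
Definition act2 (a : G * H) : nat_trans C := map2 Phi a.

Lemma act2_dom a : nt_dom (act2 a) = act1 a.1.
Proof. exact: (fun_src (map_vert Phi)). Qed.

Lemma act2_cod a : nt_cod (act2 a) = act1 (tg_tgt a).
Proof. exact: (fun_tgt (map_vert Phi)). Qed.

Lemma act1_1 : act1 1 = endo_id C.
Proof. exact: (fun_id (map_cells1 Phi) tt). Qed.

Lemma act1_M g g' : act1 (g * g') = endo_comp (act1 g) (act1 g').
Proof. exact: (fun_comp (map_cells1 Phi) (g := g) (f := g') erefl erefl). Qed.

Lemma act2_id g : act2 (g, 1) = nt_id (act1 g).
Proof. exact: (fun_id (map_vert Phi) g). Qed.

Lemma act2_vcomp b a e (e' : tg_tgt a = tg_src b) :
  act2 (tg_vcomp b a) = ccomp (endo_vert C) (act2 b) (act2 a) e.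
Proof. exact: (fun_comp (map_vert Phi) (g := b) (f := a) e' e). Qed.

Lemma act2_hcomp b a : act2 (tg_hcomp b a) = nt_hcomp (act2 b) (act2 a).
Proof. exact: (fun_comp (map_horz Phi) (g := b) (f := a) erefl erefl). Qed.

Lemma act2_mor_proof (a : G * H) (f : mor C) :
  tgt C (on_mor (act1 a.1) f) = src C (nt_at (act2 a) (tgt C f)).
Proof. by rewrite (fun_tgt (endoP _)) nt_at_src act2_dom. Qed.

Definition act2_mor (a : G * H) (f : mor C) : mor C :=
  ccomp C (nt_at (act2 a) (tgt C f)) (on_mor (act1 a.1) f) (act2_mor_proof a f).

Lemma act2_mor_src a f : src C (act2_mor a f) = on_ob (act1 a.1) (src C f).
Proof. by rewrite src_comp (fun_src (endoP _)). Qed.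

Lemma act2_mor_tgt a f :
  tgt C (act2_mor a f) = on_ob (act1 (tg_tgt a)) (tgt C f).
Proof. by rewrite tgt_comp nt_at_tgt act2_cod. Qed.

Lemma act2_mor_idl g f : act2_mor (g, 1) f = on_mor (act1 g) f.
Proof.
rewrite /act2_mor; move: (act2_mor_proof _ _); rewrite act2_id => e.
exact: comp_id_l.
Qed.

Lemma act2_mor_hcomp b a f :
  act2_mor (tg_hcomp b a) f = act2_mor b (act2_mor a f).
Proof.
have p1 : tgt C (on_mor (act1 b.1) (nt_at (act2 a) (tgt C f))) =
          src C (nt_at (act2 b) (tgt C (act2_mor a f))).
  by rewrite (fun_tgt (endoP _)) !nt_at_tgt nt_at_src act2_dom
     tgt_comp nt_at_tgt.
have p2 : tgt C (on_mor (act1 b.1) (on_mor (act1 a.1) f)) =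
          src C (on_mor (act1 b.1) (nt_at (act2 a) (tgt C f))).
  by rewrite (fun_tgt (endoP _)) (fun_src (endoP _)) act2_mor_proof.
have p3 : tgt C (on_mor (act1 b.1) (on_mor (act1 a.1) f)) =
          src C (ccomp C _ _ p1) by rewrite src_comp.
have p4 : tgt C (ccomp C _ _ p2) =
          src C (nt_at (act2 b) (tgt C (act2_mor a f))) by rewrite tgt_comp.
transitivity (ccomp C _ _ p3).
  apply: comp_congr; last by rewrite act1_M.
  rewrite act2_hcomp; apply: comp_congr; last by rewrite act2_dom.
  by rewrite act2_mor_tgt act2_cod.
rewrite -(compA p2 p4); apply: comp_congr => //.
by apply: esym; exact: (fun_comp (endoP _)).
Qed.

Lemma act2_mor_vcomp b a g f (ba : tg_tgt a = tg_src b) e e' :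
  act2_mor (tg_vcomp b a) (ccomp C g f e) =
  ccomp C (act2_mor b g) (act2_mor a f) e'.
Proof.
have c : tgt (endo_vert C) (act2 a) = src (endo_vert C) (act2 b).
  by rewrite /= act2_cod act2_dom ba.
have p1 : tgt C (nt_at (act2 a) (tgt C g)) = src C (nt_at (act2 b) (tgt C g)).
  exact: nt_vcomp_proof.
have p2 : tgt C (on_mor (act1 a.1) f) = src C (on_mor (act1 a.1) g).
  by rewrite (fun_tgt (endoP _)) (fun_src (endoP _)) e.
have m1 : tgt C (on_mor (nt_dom (act2 a)) g) = src C (nt_at (act2 a) (tgt C g)).
  by rewrite (fun_tgt (endoP _)) nt_at_src.
have m2 : tgt C (nt_at (act2 a) (src C g)) = src C (on_mor (nt_cod (act2 a)) g).
  by rewrite (fun_src (endoP _)) nt_at_tgt.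
have n1 : tgt C (on_mor (act1 a.1) g) = src C (nt_at (act2 a) (tgt C g)).
  by rewrite -act2_dom.
have n2 : tgt C (nt_at (act2 a) (tgt C f)) = src C (on_mor (act1 b.1) g).
  by rewrite e m2 act2_cod ba.
have nat_a : ccomp C _ _ n1 = ccomp C _ _ n2.
  transitivity (ccomp C _ _ m1); first by apply: comp_congr; rewrite ?act2_dom.
  by rewrite (nt_natural m1 m2); apply: comp_congr; rewrite ?e // act2_cod ba.
have q : tgt C (ccomp C _ _ p2) = src C (ccomp C _ _ p1).
  by rewrite src_comp tgt_comp n1.
transitivity (ccomp C _ _ q); last exact: (comp_exchange _ _ nat_a).
apply: comp_congr; last exact: (fun_comp (endoP _)).
by rewrite (act2_vcomp c ba) tgt_comp; exact: comp_congr.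
Qed.

Definition tr_vmor : Type := (G * ob C)%type.
Definition tr_square : Type := (G * H * mor C)%type.

Definition tr_ver : cat_on (ob C) tr_vmor.
Proof.
refine (@CatOn _ tr_vmor snd (fun u => on_ob (act1 u.1) u.2)
  (fun x => (1, x)) (fun v u _ => (v.1 * u.1, u.2)) _ _ _ _ _ _ _) => //.
- by move=> x; rewrite act1_1.
- by move=> v u e; rewrite /= act1_M /= e.
- by move=> [g x] _; rewrite /= mul1g.
- by move=> [g x] _; rewrite /= mulg1.
- by move=> w v u *; rewrite /= mulgA.
Defined.

Definition tr_sqv : cat_on (mor C) tr_square.
Proof.
refine (@CatOn _ tr_square snd (fun s => act2_mor s.1 s.2)
  (fun f => ((1, 1), f)) (fun t s _ => (tg_hcomp t.1 s.1, s.2))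
  _ _ _ _ _ _ _) => //.
- by move=> f; rewrite act2_mor_idl act1_1.
- by move=> t s e; rewrite /= act2_mor_hcomp e.
- by move=> [[g h] f] _; rewrite /tg_hcomp /= !mul1g xact1.
- by move=> [[g h] f] _; rewrite /tg_hcomp /= xact_1 !mulg1.
- by move=> u t s *; rewrite /tg_hcomp /= xact_mul xactM !mulgA.
Defined.

Definition tr_left (s : tr_square) : tr_vmor := (s.1.1, src C s.2).
Definition tr_right (s : tr_square) : tr_vmor := (tg_tgt s.1, tgt C s.2).

Lemma tr_hcomp_proof (t s : tr_square) :
  tr_right s = tr_left t -> tgt C s.2 = src C t.2.
Proof. by case. Qed.

Definition tr_hcomp (t s : tr_square) (e : tr_right s = tr_left t) :
    tr_square :=
  (tg_vcomp t.1 s.1, ccomp C t.2 s.2 (tr_hcomp_proof e)).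

Definition tr_sqh : cat_on tr_vmor tr_square.
Proof.
refine (@CatOn _ tr_square tr_left tr_right
  (fun u => ((u.1, 1), idm C u.2)) tr_hcomp _ _ _ _ _ _ _).
- by move=> [g x]; rewrite /tr_left /= src_id.
- by move=> [g x]; rewrite /tr_right /tg_tgt /= bd1 mul1g tgt_id.
- by move=> t s e; rewrite /tr_left /= src_comp.
- move=> t s e; rewrite /tr_right /= tgt_comp; congr pair.
  have e1 : tgt (tg_vert X) s.1 = src (tg_vert X) t.1 by case: e.
  exact: (tgt_comp e1).
- by move=> [[g h] f] e; rewrite /tr_hcomp /tg_vcomp /= mul1g comp_id_l.
- by move=> [[g h] f] e; rewrite /tr_hcomp /tg_vcomp /= mulg1 comp_id_r.
- move=> u t s *; rewrite /tr_hcomp /tg_vcomp /= mulgA; congr pair.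
  exact: compA.
Defined.

Definition transformation_dcat : double_category.
Proof.
refine (@DoubleCategory (ob C) (mor C) tr_vmor tr_square C tr_ver tr_sqh tr_sqv
  _ _ _ _ _ _ _ _ _ _ _ _ _ _ _ _) => //.
- by move=> s; exact: act2_mor_src.
- by move=> s; exact: act2_mor_tgt.
- by move=> t s e e'; exact: comp_congr.
- by move=> t s e e'; apply: act2_mor_vcomp; case: e.
- by move=> t s e e'; rewrite /= /tr_right tg_tgt_hcomp.
- by move=> [g x]; rewrite /= act2_mor_idl (fun_id (endoP _)).
- by move=> f; rewrite /= /tr_right /tg_tgt /= bd1 mul1g.
- by move=> v u e e'; rewrite /= /tg_hcomp /= xact_1 mul1g.
- move=> g f e e'; rewrite /= /tr_hcomp /tg_vcomp /= mul1g; congr pair.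
  exact: comp_congr.
- move=> t' t s' s e1 e2 e3 e4 e5 e6.
  have f1 : tg_tgt s'.1 = tg_src t'.1 by case: (e1).
  have f2 : tg_tgt s.1 = tg_src t.1 by case: (e2).
  have f3 : tg_tgt (tg_hcomp s'.1 s.1) = tg_src (tg_hcomp t'.1 t.1).
    by rewrite tg_tgt_hcomp f1 f2.
  rewrite /= /tr_hcomp /=; congr pair; last exact: comp_congr.
  apply: esym; exact: (@interchange (two_group X) t'.1 s'.1 t.1 s.1
    erefl erefl f3 f1 f2 erefl).
Defined.

Definition square_label
    (s : cell2 (horizontal_2cat transformation_dcat)) : cell2 (two_group X) :=
  (sval s).1.

End TransformationDoubleCategory.

(* Main.v *)
Require Import Defs.
From mathcomp Require Import all_boot.
From mathcomp Require Import boolp classical_sets functions.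

Local Open Scope group_scope.
Local Open Scope classical_set_scope.

(* A square ((g, chi), f) has identity vertical edges iff g = 1 and
   d(chi) = 1. Its bottom edge is then Phi_(1, chi)(y) o f, which naturality of
   Phi_(1, chi) : id => id turns into f o Phi_(1, chi)(x). Since xact 1 is the
   identity, tg_hcomp and tg_vcomp agree on such labels; this is why the swap
   of directions (horizontal composition of squares uses the vertical
   composition of the 2-group, and conversely) is invisible. *)

Section SquaresWithIdentityEdges.

Variables (X : crossed_module) (C : category) (Phi : strict_action X C).

Local Notation DC := (transformation_dcat Phi).

Lemma is_identity_tr_vmor (u : dvmor DC) : is_identity u <-> u.1 = 1.
Proof.
by split=> [[x ->]|u1] //; exists u.2; rewrite [LHS]surjective_pairing u1.
Qed.

(** The left edge of a square carries the first component of its label, the right edge the target of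
    the label in the 2-group. *)
Lemma hsquare_label (s : hsquare DC) :
  (square_label s).1 = 1 /\ tg_tgt (square_label s) = 1.
Proof. by case: (svalP s) => /is_identity_tr_vmor ? /is_identity_tr_vmor. Qed.

(** Both ends of [act2 Phi a] are the identity functor, so its naturality square at [f] moves the
    component from the target of [f] to its source. *)
Lemma act2_mor_endo1 (a : xG X * xH X) (f : mor C)
    (a1 : a.1 = 1) (ta : tg_tgt a = 1)
    (e : tgt C (nt_at (act2 Phi a) (src C f)) = src C f) :
  act2_mor Phi a f = ccomp C f (nt_at (act2 Phi a) (src C f)) e.
Proof.
have domE : nt_dom (act2 Phi a) = endo_id C by rewrite act2_dom a1 act1_1.
have codE : nt_cod (act2 Phi a) = endo_id C by rewrite act2_cod ta act1_1.
have e1 : tgt C (on_mor (nt_dom (act2 Phi a)) f) =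
          src C (nt_at (act2 Phi a) (tgt C f)) by rewrite nt_at_src domE.
have e2 : tgt C (nt_at (act2 Phi a) (src C f)) =
          src C (on_mor (nt_cod (act2 Phi a)) f) by rewrite codE.
transitivity (ccomp C _ _ e1); first by apply: comp_congr; rewrite ?act2_dom.
by rewrite (nt_natural e1 e2); apply: comp_congr; rewrite ?codE.
Qed.

End SquaresWithIdentityEdges.

Arguments is_identity_tr_vmor {X C Phi u}.
Arguments hsquare_label {X C Phi} s.
Arguments act2_mor_endo1 {X C Phi a f}.

Theorem theorem4p16 (X : crossed_module) (C : category)
    (Phi : strict_action X C) :
  let HC := horizontal_2cat (transformation_dcat Phi) in
  [/\ Category (cells1 HC) = C,
      (forall (x y : ob C) (f f' : mor C),
         src C f = x -> tgt C f = y -> src C f' = x -> tgt C f' = y ->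
         set_bij
           [set s : cell2 HC | src (vert HC) s = f /\ tgt (vert HC) s = f']
           [set a : cell2 (two_group X) |
              [/\ src (vert (two_group X)) a = 1,
                  tgt (vert (two_group X)) a = 1 &
                  exists e, f' = ccomp C f (nt_at (map2 Phi a) x) e]]
           (@square_label X C Phi)),
      (forall (t s : cell2 HC) (e : tgt (horz HC) s = src (horz HC) t),
         exists e', square_label (ccomp (horz HC) t s e) =
           ccomp (horz (two_group X)) (square_label t) (square_label s) e') &
      (forall (t s : cell2 HC) (e : tgt (vert HC) s = src (vert HC) t),
         exists e', square_label (ccomp (vert HC) t s e) =
           ccomp (vert (two_group X)) (square_label t) (square_label s) e')].
Proof.
move=> HC; split.
(* Once [C] is destructed, repacking its structure with [Category] gives [C] by computation. *)
- by rewrite {}/HC; case: C Phi.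
- move=> x y f f' <- _ _ _; split.
  + move=> s [sf sf']; have [s1 s2] := hsquare_label s; split=> //.
    have e : tgt C (nt_at (act2 Phi (square_label s)) (src C f)) = src C f.
      by rewrite nt_at_tgt act2_cod s2 act1_1.
    exists e; rewrite -(act2_mor_endo1 s1 s2).
    by rewrite -sf' -sf.
  (* A square is its label together with its top edge, and both top edges are [f]. *)
  + move=> s t /set_mem [sf _] /set_mem [tf _] st; apply: hsquare_eq.
    by rewrite [LHS]surjective_pairing [RHS]surjective_pairing; congr pair;
      [exact: st | exact: etrans sf (esym tf)].
  + move=> a [a1 a2 [e ->]].
    (* The preimage of [a] is the square with label [a] and top edge [f]. *)
    have aP : is_identity (src (sqh (transformation_dcat Phi)) (a, f)) /\
              is_identity (tgt (sqh (transformation_dcat Phi)) (a, f)).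
      by split; apply/is_identity_tr_vmor.
    exists (exist _ (a, f) aP) => //; split=> //.
    exact: act2_mor_endo1.
(* The 2-group has a single object, so [erefl] proves composability. *)
- move=> t s e; exists erefl; have [t1 _] := hsquare_label t.
  have [s1 _] := hsquare_label s; move: t1 s1.
  by rewrite /= /tg_hcomp /square_label /= /tg_vcomp => -> ->; rewrite mul1g xact1.
- move=> t s e; have [t1 _] := hsquare_label t; have [s1 s2] := hsquare_label s.
  (* Labels start and end at 1, so any two compose vertically in the 2-group. *)
  have e' : tgt (vert (two_group X)) (square_label s) =
            src (vert (two_group X)) (square_label t) by rewrite /= s2.
  exists e'; move: t1 s1.
  by rewrite /= /tg_vcomp /square_label /= /tg_hcomp => -> ->; rewrite mul1g xact1.
Qed.
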